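(* Let $A,B$ be $n\times n$ positive definite matrices and let $t\in[-\tfrac12,0]\cup[1,\tfrac32]$. Then \[ A\,\widehat{sp}_t\,B\prec_{\log}A^{\frac{1-t}{2}}B^tA^{\frac{1-t}{2}}. \]
   Context: For positive definite matrices $A,B$ and $t\in\mathbb{R}$: $A\sharp B:=A^{1/2}(A^{-1/2}BA^{-1/2})^{1/2}A^{1/2}$ and $A\,\widehat{sp}_t\,B:=(A^{-1}\sharp B)^tA(A^{-1}\sharp B)^t$. For $n\times n$ positive semidefinite matrices $X,Y$ with eigenvalues $\lambda_1(\cdot)\ge\dots\ge\lambda_n(\cdot)$, $X\prec_{\log}Y$ means $\prod_{j=1}^k\lambda_j(X)\le\prod_{j=1}^k\lambda_j(Y)$ for $k=1,\dots,n-1$ and $\det X=\det Y$. *)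

(* Defs.v *)
From HB Require Import structures.
From mathcomp Require Import all_boot all_order all_algebra.
From mathcomp Require Import complex.
From mathcomp Require Import boolp reals exp.
Set Implicit Arguments. Unset Strict Implicit. Unset Printing Implicit Defensive.
Import Order.TTheory GRing.Theory Num.Theory.
Local Open Scope ring_scope.

Section MatrixFunctions.
Variables (R : realType) (n : nat).
Local Notation C := R[i].
Local Notation M := 'M[C]_n.

Definition rC (r : R) : C := Complex r 0.

Definition mxadj (m p : nat) (X : 'M[C]_(m, p)) : 'M[C]_(p, m) :=
  (map_mx Num.conj X)^T.

Definition unitarymx (U : M) : Prop := U *m mxadj U = 1%:M.

Definition posdef (A : M) : Prop :=
  A = mxadj A /\
  forall x : 'cV[C]_n, x != 0 -> 0 < (mxadj x *m A *m x) 0 0.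

Definition spec_dec (A : M) (U : M) (d : 'rV[R]_n) : Prop :=
  unitarymx U /\ A = U *m diag_mx (map_mx rC d) *m mxadj U.

(* real power A^s of a positive definite matrix via its spectral
   decomposition (the result does not depend on the chosen decomposition);
   0 if A admits no such decomposition with positive spectrum *)
Definition mpow (A : M) (s : R) : M :=
  match pselect (exists p : M * 'rV[R]_n,
                   spec_dec A p.1 p.2 /\ forall i, 0 < p.2 0 i) with
  | left h => let p := proj1_sig (cid h) in
              p.1 *m diag_mx (map_mx (fun r => rC (r `^ s)) p.2) *m mxadj p.1
  | right _ => 0
  end.

Definition gmean (A B : M) : M :=
  mpow A (2^-1) *m mpow (mpow A (- 2^-1) *m B *m mpow A (- 2^-1)) (2^-1)
        *m mpow A (2^-1).

Definition sphat (A B : M) (t : R) : M :=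
  mpow (gmean (invmx A) B) t *m A *m mpow (gmean (invmx A) B) t.

(* eigenvalues lambda_1 >= ... >= lambda_n of a positive semidefinite
   (Hermitian) matrix, obtained from a spectral decomposition with a
   nonincreasing nonnegative diagonal; 0 if none exists *)
Definition eigs (X : M) : 'I_n -> R :=
  match pselect (exists p : M * 'rV[R]_n,
                   [/\ spec_dec X p.1 p.2, (forall i, 0 <= p.2 0 i) &
                       forall i j : 'I_n, (i <= j)%N -> p.2 0 j <= p.2 0 i])
  with
  | left h => fun i => (proj1_sig (cid h)).2 0 i
  | right _ => fun _ => 0
  end.

Definition logmaj (X Y : M) : Prop :=
  (forall k : nat, (1 <= k <= n.-1)%N ->
     \prod_(j < n | (j < k)%N) eigs X j <= \prod_(j < n | (j < k)%N) eigs Y j)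
  /\ \det X = \det Y.

End MatrixFunctions.

(* Main.v *)
Require Import Defs.
From HB Require Import structures.
From mathcomp Require Import all_boot all_order all_fingroup all_algebra.
From mathcomp Require Import complex ring lra.
From mathcomp Require Import boolp reals topology normedtype sequences exp.
Set Implicit Arguments. Unset Strict Implicit. Unset Printing Implicit Defensive.
Import Order.TTheory GRing.Theory Num.Theory.
Import numFieldNormedType.Exports.
Local Open Scope ring_scope.

(* Put [G = A^-1 # B], the positive solution of [G A G = B], so that the left hand
   side is [G^t A G^t].  Exchanging [A] and [B] replaces [G] by [G^-1] and [t] by
   [1 - t], so let [t = - s] with [0 <= s <= 1/2], and write [K = A^-1], [H = G^-1],
   so that [B^-1 = H K H].  For the largest eigenvalues one has to show that
   [(H K H)^s <= c K^(1+s)] implies [H^(2s) <= c K].  Take [c = 1] and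
   [Q = (H K H)^(1/(2+2s))].  The Loewner-Heinz inequality with exponent [1/(1+s)]
   gives [Q^(2s) <= K], that is [H Q^(2s) H <= Q^(2+2s)]; hence
   [(Q^s H Q^s)^2 <= Q^(2+4s)], and taking square roots [H <= Q].  As [2s <= 1],
   [H^(2s) <= Q^(2s)], so [H H^(2s) H <= H Q^(2s) H <= Q^(2+2s) = H K H], which is
   the claim.  The products of the [k] largest eigenvalues are the largest
   eigenvalues on antisymmetric tensors of rank [k], and the passage to these
   tensors is multiplicative and commutes with real powers.  *)

(** * Adjoints, quadratic forms and the spectral theorem for positive definite matrices *)

Section Adjoint.
Variable R : realType.
Local Notation C := R[i].

Lemma rC0 : rC 0 = 0 :> C. Proof. by []. Qed.
Lemma rC1 : rC 1 = 1 :> C. Proof. by []. Qed.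
Lemma rCM (x y : R) : rC (x * y) = rC x * rC y.
Proof. exact: (rmorphM (real_complex R)). Qed.
Lemma rC_sum (I : Type) (r : seq I) (P : pred I) (F : I -> R) :
  rC (\sum_(i <- r | P i) F i) = \sum_(i <- r | P i) rC (F i).
Proof. exact: (rmorph_sum (real_complex R)). Qed.
Lemma rC_prod (I : Type) (r : seq I) (P : pred I) (F : I -> R) :
  rC (\prod_(i <- r | P i) F i) = \prod_(i <- r | P i) rC (F i).
Proof. exact: (rmorph_prod (real_complex R)). Qed.
Lemma rC_le (x y : R) : (rC x <= rC y) = (x <= y). Proof. exact: lecR. Qed.
Lemma rC_lt (x y : R) : (rC x < rC y) = (x < y). Proof. exact: ltcR. Qed.
Lemma rC_inj : injective (@rC R). Proof. exact: complexI. Qed.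
Lemma conj_rC (x : R) : Num.conj (rC x) = rC x.
Proof. by apply/CrealP/complex_realP; exists x. Qed.
Lemma rC_gt0P (z : C) : 0 < z -> z = rC (complex.Re z).
Proof. by move=> z0; rewrite -[RHS]/((complex.Re z)%:C)%C RRe_real ?gtr0_real. Qed.

Lemma mulmx_col (T : pzSemiRingType) m p q (X : 'M[T]_(m, p)) (Y : 'M[T]_(p, q)) i :
  X *m col i Y = col i (X *m Y).
Proof. by apply/matrixP => a b; rewrite !mxE; apply: eq_bigr => j _; rewrite !mxE. Qed.

Lemma col_neq0 m n (S : 'M[C]_(n, m)) (T : 'M[C]_(m, n)) i :
  S *m T = 1%:M -> col i T != 0.
Proof.
move=> ST; apply/eqP => e; have := congr1 (mulmx S) e.
rewrite mulmx0 mulmx_col ST => /matrixP/(_ i 0).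
by rewrite !mxE eqxx => /eqP; rewrite oner_eq0.
Qed.

Lemma mxadjE m p (X : 'M[C]_(m, p)) i j : mxadj X i j = Num.conj (X j i).
Proof. by rewrite !mxE. Qed.

Lemma mxadjK m p (X : 'M[C]_(m, p)) : mxadj (mxadj X) = X.
Proof. by apply/matrixP=> i j; rewrite !mxadjE conjCK. Qed.

Lemma mxadjM m p q (X : 'M[C]_(m, p)) (Y : 'M[C]_(p, q)) :
  mxadj (X *m Y) = mxadj Y *m mxadj X.
Proof. by rewrite /mxadj map_mxM trmx_mul. Qed.

Lemma mxadjZ m p (r : R) (X : 'M[C]_(m, p)) : mxadj (rC r *: X) = rC r *: mxadj X.
Proof. by apply/matrixP=> i j; rewrite !mxE rmorphM/= conj_rC. Qed.

Definition rdiag n (d : 'rV[R]_n) : 'M[C]_n := diag_mx (map_mx (@rC R) d).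

Lemma rdiagE n (d : 'rV[R]_n) i j : rdiag d i j = rC (d 0 i) *+ (i == j).
Proof. by rewrite /rdiag !mxE. Qed.

Lemma mxadj_rdiag n (d : 'rV[R]_n) : mxadj (rdiag d) = rdiag d.
Proof.
apply/matrixP=> i j; rewrite mxadjE !rdiagE eq_sym.
by case: eqP => [->|_]; rewrite ?mulr1n ?mulr0n ?conj_rC ?conjC0.
Qed.

Lemma mul_rdiag n (d e : 'rV[R]_n) :
  rdiag d *m rdiag e = rdiag (\row_i (d 0 i * e 0 i)).
Proof.
rewrite /rdiag mulmx_diag; congr diag_mx; apply/rowP=> i.
by rewrite !mxE rCM.
Qed.

Definition qf n (X : 'M[C]_n) (x : 'cV[C]_n) : C := (mxadj x *m X *m x) 0 0.

Lemma qf_congr m n (T : 'M[C]_(m, n)) X x :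
  qf (mxadj T *m X *m T) x = qf X (T *m x).
Proof. by rewrite /qf mxadjM !mulmxA. Qed.

Lemma qfZ n (a : C) (X : 'M[C]_n) x : qf (a *: X) x = a * qf X x.
Proof. by rewrite /qf -scalemxAr -scalemxAl mxE. Qed.

Lemma qf_eigen n (X : 'M[C]_n) x a : X *m x = a *: x -> qf X x = a * qf 1%:M x.
Proof. by move=> e; rewrite /qf -mulmxA e mulmx1 -scalemxAr mxE. Qed.

Lemma qf1E n (x : 'cV[C]_n) : qf 1%:M x = \sum_i `|x i 0| ^+ 2.
Proof.
rewrite /qf mulmx1 !mxE; apply: eq_bigr => i _.
by rewrite !mxE normCK mulrC.
Qed.

Lemma qf1_ge0 n (x : 'cV[C]_n) : 0 <= qf 1%:M x.
Proof. by rewrite qf1E sumr_ge0 // => i _; rewrite exprn_ge0. Qed.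

Lemma qf1_eq0 n (x : 'cV[C]_n) : (qf 1%:M x == 0) = (x == 0).
Proof.
apply/idP/eqP => [|->]; last by rewrite /qf mulmx0 mxE.
rewrite qf1E psumr_eq0 => [|i _]; last by rewrite exprn_ge0.
move=> /allP h; apply/matrixP => i j; rewrite ord1 mxE.
have := h i (mem_index_enum _); rewrite expf_eq0/= normr_eq0.
by move/eqP.
Qed.

Lemma qf1_gt0 n (x : 'cV[C]_n) : x != 0 -> 0 < qf 1%:M x.
Proof. by move=> x0; rewrite lt_neqAle qf1_ge0 eq_sym qf1_eq0 x0. Qed.

Lemma qf_rdiag n (d : 'rV[R]_n) x :
  qf (rdiag d) x = \sum_i rC (d 0 i) * `|x i 0| ^+ 2.
Proof.
rewrite /qf !mxE; apply: eq_bigr => i _; rewrite mxE (bigD1 i)//= big1.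
  by rewrite addr0 mxadjE rdiagE eqxx mulr1n normCK; ring.
by move=> j /negPf ji; rewrite rdiagE ji mulr0n mulr0.
Qed.

Lemma posdef_qf n (A : 'M[C]_n) x : posdef A -> x != 0 -> 0 < qf A x.
Proof. by move=> [_]; apply. Qed.

Lemma posdef_adj n (A : 'M[C]_n) : posdef A -> mxadj A = A.
Proof. by case. Qed.

Lemma posdef_congr m n (T : 'M[C]_(m, n)) A :
  posdef A -> (forall x : 'cV_n, T *m x = 0 -> x = 0) ->
  posdef (mxadj T *m A *m T).
Proof.
move=> pA injT; split=> [|x x0]; first by rewrite !mxadjM mxadjK posdef_adj// mulmxA.
rewrite -/(qf _ _) qf_congr; apply: posdef_qf => //.
by apply: contra_neq x0; exact: injT.
Qed.

Lemma unitmx_inj m n (S : 'M[C]_(n, m)) (T : 'M[C]_(m, n)) : S *m T = 1%:M ->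
  forall x : 'cV_n, T *m x = 0 -> x = 0.
Proof. by move=> ST x e; rewrite -[x]mul1mx -ST -mulmxA e mulmx0. Qed.

Lemma posdef_congr_herm n (T : 'M[C]_n) (A S : 'M[C]_n) :
  posdef A -> mxadj T = T -> S *m T = 1%:M -> posdef (T *m A *m T).
Proof.
move=> pA hT ST; rewrite -[X in X *m A]hT; apply: posdef_congr => //.
exact: unitmx_inj ST.
Qed.

Lemma posdef_inj n (A : 'M[C]_n) : posdef A -> forall x : 'cV_n, A *m x = 0 -> x = 0.
Proof.
move=> pA x e; apply/eqP; case: (eqVneq x 0) => // x0.
by have := posdef_qf pA x0; rewrite /qf -mulmxA e mulmx0 mxE ltxx.
Qed.

Lemma posdef_unit n (A : 'M[C]_n) : posdef A -> A \in unitmx.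
Proof.
move=> pA; rewrite -unitmx_tr -row_free_unit; apply: inj_row_free => v e.
apply: trmx_inj; rewrite trmx0; apply: (posdef_inj pA).
by rewrite -[A]trmxK -trmx_mul e trmx0.
Qed.

Lemma posdefZ n (A : 'M[C]_n) (c : R) : 0 < c -> posdef A -> posdef (rC c *: A).
Proof.
move=> c0 pA; split=> [|x x0]; first by rewrite mxadjZ posdef_adj.
by rewrite -/(qf _ _) qfZ mulr_gt0 ?rC_lt//; exact: posdef_qf.
Qed.

Definition spectral_form n (U : 'M[C]_n) (d : 'rV[R]_n) : 'M[C]_n :=
  U *m rdiag d *m mxadj U.

Lemma spec_decE n (A U : 'M[C]_n) d : spec_dec A U d ->
  [/\ U *m mxadj U = 1%:M, mxadj U *m U = 1%:M & A = spectral_form U d].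
Proof. by case=> UU ->; split=> //; exact: mulmx1C. Qed.

Lemma posdef_spectral_form n (U : 'M[C]_n) (d : 'rV[R]_n) : U *m mxadj U = 1%:M ->
  (forall i, 0 < d 0 i) -> posdef (spectral_form U d).
Proof.
move=> UU d0; rewrite /spectral_form -[X in X *m _ *m _]mxadjK.
apply: posdef_congr; last exact: unitmx_inj UU.
split=> [|x x0]; first by rewrite mxadj_rdiag.
rewrite -/(qf _ _) qf_rdiag.
have t0 i : 0 <= rC (d 0 i) * `|x i 0| ^+ 2.
  by rewrite mulr_ge0 ?exprn_ge0// ltW// rC_lt.
rewrite lt_neqAle sumr_ge0// andbT eq_sym psumr_eq0//.
apply: contra x0 => /allP h; apply/eqP/matrixP => i j; rewrite ord1 mxE.
have := h i (mem_index_enum _); rewrite mulf_eq0 expf_eq0/= normr_eq0.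
by rewrite -[X in rC _ == X]rC0 (inj_eq rC_inj) gt_eqF//= => /eqP.
Qed.

Lemma posdef_spectral_gt0 n (A U : 'M[C]_n) (d : 'rV[R]_n) :
  posdef A -> spec_dec A U d -> forall i, 0 < d 0 i.
Proof.
move=> pA /spec_decE[UU U'U eA] i.
have x0 : col i U != 0 by exact: col_neq0 U'U.
have := posdef_qf pA x0; rewrite eA /spectral_form -[X in X *m _ *m _]mxadjK.
rewrite qf_congr mulmx_col U'U qf_rdiag (bigD1 i)//= big1.
  by rewrite !mxE eqxx normr1 expr1n mulr1 addr0 rC_lt.
by move=> j /negPf ji; rewrite !mxE ji normr0 expr0n mulr0.
Qed.

(** A Hermitian matrix is normal, hence unitarily diagonalizable over [C]; evaluating the form at
    the eigenvectors shows that the eigenvalues are positive, so taking real parts loses nothing. *)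
Lemma posdef_spec_dec n (A : 'M[C]_n) : posdef A ->
  exists p : 'M[C]_n * 'rV[R]_n, spec_dec A p.1 p.2 /\ forall i, 0 < p.2 0 i.
Proof.
move=> pA; have hA := posdef_adj pA.
have adjE m p (X : 'M[C]_(m, p)) : map_mx Num.conj X^T = mxadj X.
  by rewrite /mxadj map_trmx.
have nA : A \is spectral.normalmx by apply/spectral.normalmxP; rewrite !adjE hA.
have := spectral.orthomx_spectralP nA.
have := spectral.spectral_unitarymx A.
set V := spectral.spectralmx A; set e := spectral.spectral_diag A => Vu.
rewrite spectral.invmx_unitary// adjE => eA.
move/spectral.unitarymxP: Vu; rewrite adjE => VV.
have V'V := mulmx1C VV.
have e0 i : 0 < e 0 i.
  have x0 : col i (mxadj V) != 0 by exact: col_neq0 VV.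
  have := posdef_qf pA x0; rewrite [in qf _]eA qf_congr mulmx_col VV.
  rewrite /qf !mxE (bigD1 i)//= big1 => [|j /negPf ji]; last first.
    by rewrite !mxE ji mulr0.
  rewrite addr0 !mxE (bigD1 i)//= big1 => [|j /negPf ji]; last first.
    by rewrite !mxE ji conjC0 mul0r.
  by rewrite !mxE eqxx conjC1 mul1r addr0 mulr1.
exists (mxadj V, map_mx (@complex.Re R) e); split=> [|i]; last first.
  by rewrite mxE -rC_lt -rC_gt0P.
split; first by rewrite /Defs.unitarymx mxadjK.
rewrite [LHS]eA mxadjK; congr (_ *m diag_mx _ *m _).
by apply/rowP=> i; rewrite !mxE -rC_gt0P.
Qed.

End Adjoint.

(** * Real powers, determinants, and the geometric mean as a Riccati solution *)

Section Powers.
Variable R : realType.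
Local Notation C := R[i].

(* In the two eigenbases an intertwiner only couples equal eigenvalues. *)
Lemma spectral_form_intertwine m n (f : R -> R) (U : 'M[C]_m) (V : 'M[C]_n)
    (d : 'rV[R]_m) (e : 'rV[R]_n) (T : 'M[C]_(m, n)) :
  U *m mxadj U = 1%:M -> V *m mxadj V = 1%:M ->
  spectral_form U d *m T = T *m spectral_form V e ->
  spectral_form U (map_mx f d) *m T = T *m spectral_form V (map_mx f e).
Proof.
rewrite /spectral_form; move: (mxadj U) (mxadj V) => U' V' UU VV.
have U'U := mulmx1C UU; have V'V := mulmx1C VV.
have [S ->] : exists S, T = U *m S *m V'.
  by exists (U' *m T *m V); rewrite !mulmxA UU mul1mx -mulmxA VV mulmx1.
have UK p (M : 'M_(m, p)) : U' *m (U *m M) = M by rewrite mulmxA U'U mul1mx.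
have VK p (M : 'M_(n, p)) : V' *m (V *m M) = M by rewrite mulmxA V'V mul1mx.
rewrite -!mulmxA UK VK => h; rewrite VK.
have {h}hS : rdiag d *m S = S *m rdiag e.
  have := congr1 (fun M => U' *m M *m V) h.
  by rewrite -!mulmxA !UK V'V !mulmx1.
have fS : rdiag (map_mx f d) *m S = S *m rdiag (map_mx f e).
  apply/matrixP => i j; move/matrixP/(_ i j): hS.
  rewrite /rdiag !mul_diag_mx !mul_mx_diag !mxE.
  have [->|S0] := eqVneq (S i j) 0; first by rewrite !mulr0 !mul0r.
  by rewrite [RHS]mulrC => /(mulIf S0)/rC_inj ->; rewrite mulrC.
by rewrite (mulmxA _ S) fS !mulmxA.
Qed.

(** The decomposition chosen inside [mpow] and the given one are intertwined by the identity, so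
    both produce the same power: [mpow] may be computed in any eigenbasis. *)
Lemma mpowE n (A U : 'M[C]_n) (d : 'rV[R]_n) s :
  spec_dec A U d -> (forall i, 0 < d 0 i) ->
  mpow A s = spectral_form U (map_mx (@powR R ^~ s) d).
Proof.
move=> sA d0; have [UU _ eA] := spec_decE sA.
rewrite /mpow; case: pselect => [h|[]]; last by exists (U, d).
case: (cid h) => -[V e]/= [sA' e0]; have [VV _ eA'] := spec_decE sA'.
have := @spectral_form_intertwine n n (@powR R ^~ s) V U e d 1%:M VV UU.
rewrite mulmx1 mul1mx -eA -eA' => /(_ erefl).
by rewrite mulmx1 mul1mx => <-; rewrite /spectral_form /rdiag -map_mx_comp.
Qed.

Lemma mpow_spec_dec n (A U : 'M[C]_n) (d : 'rV[R]_n) s :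
  spec_dec A U d -> (forall i, 0 < d 0 i) ->
  spec_dec (mpow A s) U (map_mx (@powR R ^~ s) d).
Proof. by move=> sA d0; split; [case: sA | rewrite (mpowE s sA d0)]. Qed.

Lemma mpow_intertwine m n (X : 'M[C]_m) (Y : 'M[C]_n) T s : posdef X -> posdef Y ->
  X *m T = T *m Y -> mpow X s *m T = T *m mpow Y s.
Proof.
move=> /posdef_spec_dec[[U d]/= [sX d0]] /posdef_spec_dec[[V e]/= [sY e0]].
rewrite (mpowE s sX d0) (mpowE s sY e0).
have [UU _ ->] := spec_decE sX; have [VV _ ->] := spec_decE sY.
exact: spectral_form_intertwine.
Qed.

Lemma mpow_posdef n (A : 'M[C]_n) s : posdef A -> posdef (mpow A s).
Proof.
move=> /posdef_spec_dec[[U d]/= [sA d0]]; rewrite (mpowE s sA d0).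
have [UU _ _] := spec_decE sA; apply: posdef_spectral_form => // i.
by rewrite mxE powR_gt0.
Qed.

Lemma mpow_adj n (A : 'M[C]_n) s : posdef A -> mxadj (mpow A s) = mpow A s.
Proof. by move=> pA; apply/posdef_adj/mpow_posdef. Qed.

Lemma mpow0 n (A : 'M[C]_n) : posdef A -> mpow A 0 = 1%:M.
Proof.
move=> /posdef_spec_dec[[U d]/= [sA d0]]; rewrite (mpowE 0 sA d0).
have [UU _ _] := spec_decE sA; rewrite /spectral_form.
suff -> : rdiag (map_mx (@powR R ^~ 0) d) = 1%:M by rewrite mulmx1.
by apply/matrixP => i j; rewrite rdiagE !mxE powRr0.
Qed.

Lemma mpow1 n (A : 'M[C]_n) : posdef A -> mpow A 1 = A.
Proof.
move=> /posdef_spec_dec[[U d]/= [sA d0]]; rewrite (mpowE 1 sA d0).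
have [_ _ ->] := spec_decE sA; congr spectral_form.
by apply/rowP => i; rewrite mxE powRr1// ltW.
Qed.

Lemma mpowD n (A : 'M[C]_n) s t : posdef A ->
  mpow A s *m mpow A t = mpow A (s + t).
Proof.
move=> /posdef_spec_dec[[U d]/= [sA d0]]; rewrite !(mpowE _ sA d0).
have [_ U'U _] := spec_decE sA.
rewrite /spectral_form !mulmxA -(mulmxA _ (mxadj U) U) U'U mulmx1.
rewrite -(mulmxA U) mul_rdiag; congr (_ *m rdiag _ *m _).
by apply/rowP => i; rewrite !mxE powRD// (gt_eqF (d0 i)) implybT.
Qed.

Lemma mpowM n (A : 'M[C]_n) s t : posdef A -> mpow (mpow A s) t = mpow A (s * t).
Proof.
move=> /posdef_spec_dec[[U d]/= [sA d0]].
rewrite (mpowE _ (mpow_spec_dec s sA d0)) => [|i]; last by rewrite mxE powR_gt0.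
rewrite (mpowE _ sA d0); congr spectral_form.
by apply/rowP => i; rewrite !mxE powRrM.
Qed.

Lemma mpowDE n (A : 'M[C]_n) s t u : posdef A -> s + t = u ->
  mpow A s *m mpow A t = mpow A u.
Proof. by move=> pA <-; exact: mpowD. Qed.

Lemma mpowME n (A : 'M[C]_n) s t u : posdef A -> s * t = u ->
  mpow (mpow A s) t = mpow A u.
Proof. by move=> pA <-; exact: mpowM. Qed.

Lemma mpowVK n (A : 'M[C]_n) s : posdef A -> mpow A (- s) *m mpow A s = 1%:M.
Proof. by move=> pA; rewrite mpowD// addNr mpow0. Qed.

Lemma mpowKV n (A : 'M[C]_n) s : posdef A -> mpow A s *m mpow A (- s) = 1%:M.
Proof. by move=> pA; rewrite mpowD// subrr mpow0. Qed.

Lemma mpowN1 n (A : 'M[C]_n) : posdef A -> mpow A (- 1) = invmx A.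
Proof.
move=> pA; rewrite -[LHS]mulmx1 -(mulmxV (posdef_unit pA)) mulmxA.
by rewrite -{2}(mpow1 pA) mpowVK// mul1mx.
Qed.

Lemma mpowZ n (A : 'M[C]_n) c s : 0 < c -> posdef A ->
  mpow (rC c *: A) s = rC (c `^ s) *: mpow A s.
Proof.
move=> c0 /posdef_spec_dec[[U d]/= [sA d0]]; have [UU _ eA] := spec_decE sA.
have scaleE a (e : 'rV[R]_n) : rC a *: spectral_form U e = spectral_form U (a *: e).
  rewrite /spectral_form scalemxAl scalemxAr; congr (_ *m _ *m _).
  by apply/matrixP => i j; rewrite mxE !rdiagE mxE rCM mulrnAr.
have sZ : spec_dec (rC c *: A) U (c *: d) by split=> //; rewrite eA scaleE.
rewrite (mpowE s sZ) => [|i]; last by rewrite mxE mulr_gt0.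
rewrite (mpowE s sA d0) scaleE; congr spectral_form.
by apply/rowP => i; rewrite !mxE powRM// ltW.
Qed.

Lemma powR_prod (I : Type) (r : seq I) (F : I -> R) s : (forall i, 0 <= F i) ->
  (\prod_(i <- r) F i) `^ s = \prod_(i <- r) F i `^ s.
Proof.
move=> F0; elim: r => [|i r IH]; first by rewrite !big_nil powR1.
by rewrite !big_cons powRM ?IH ?prodr_ge0.
Qed.

Lemma det_spectral_form n (U : 'M[C]_n) (d : 'rV[R]_n) : U *m mxadj U = 1%:M ->
  \det (spectral_form U d) = rC (\prod_i d 0 i).
Proof.
move=> UU; rewrite /spectral_form !det_mulmx mulrAC -det_mulmx UU det1 mul1r.
by rewrite /rdiag det_diag rC_prod; apply: eq_bigr => i _; rewrite mxE.
Qed.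

(** One [a], the product of the eigenvalues, serves all exponents, so that identities between
    determinants become identities between scalar powers. *)
Lemma det_mpow n (A : 'M[C]_n) : posdef A ->
  exists2 a, 0 < a & forall s, \det (mpow A s) = rC (a `^ s).
Proof.
move=> /posdef_spec_dec[[U d]/= [sA d0]]; have [UU _ eA] := spec_decE sA.
exists (\prod_i d 0 i) => [|s]; first by rewrite prodr_gt0.
rewrite (mpowE s sA d0) det_spectral_form// powR_prod => [|i]; last exact: ltW.
by congr rC; apply: eq_bigr => i _; rewrite mxE.
Qed.

Lemma mpow_half_sq n (A : 'M[C]_n) s : posdef A ->
  mpow A (s / 2) *m mpow A (s / 2) = mpow A s.
Proof. by move=> pA; rewrite (mpowD _ _ pA) -splitr. Qed.

Lemma gmean_invE n (A B : 'M[C]_n) : posdef A ->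
  gmean (invmx A) B = mpow A (- 2^-1) *m
    mpow (mpow A 2^-1 *m B *m mpow A 2^-1) 2^-1 *m mpow A (- 2^-1).
Proof.
move=> pA; rewrite /gmean -(mpowN1 pA) !(mpowM _ _ pA).
by rewrite mulrNN mul1r mulN1r.
Qed.

Lemma gmean_inv_posdef n (A B : 'M[C]_n) : posdef A -> posdef B ->
  posdef (gmean (invmx A) B).
Proof.
move=> pA pB; rewrite (gmean_invE _ pA).
apply: posdef_congr_herm (mpow_adj _ pA) (mpowKV _ pA); apply: mpow_posdef.
exact: posdef_congr_herm pB (mpow_adj _ pA) (mpowVK _ pA).
Qed.

(** With [h = A^(1/2)], [k = A^(-1/2)] and [r = (h B h)^(1/2)] the mean is [k r k]; as [k A k = 1],
    the product collapses to [k r r k = k h B h k = B]. *)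
Lemma gmean_inv_riccati n (A B : 'M[C]_n) : posdef A -> posdef B ->
  gmean (invmx A) B *m A *m gmean (invmx A) B = B.
Proof.
move=> pA pB; rewrite (gmean_invE _ pA).
have hk := mpowVK 2^-1 pA; have kh := mpowKV 2^-1 pA.
have pM := posdef_congr_herm pB (mpow_adj 2^-1 pA) hk.
have AE : A = mpow A 2^-1 *m mpow A 2^-1 by rewrite -div1r (mpow_half_sq _ pA) mpow1.
have := mpow_half_sq 1 pM; rewrite (mpow1 pM) div1r.
move: (mpow (_ *m B *m _) _) => r.
move: (mpow A _) (mpow A _) AE hk kh => h k -> hk kh rr.
rewrite !mulmxA -(mulmxA _ h k) hk mulmx1 -(mulmxA _ k h) kh mulmx1.
by rewrite -(mulmxA _ r r) rr !mulmxA hk mul1mx -mulmxA kh mulmx1.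
Qed.

End Powers.

(** * The Loewner order and the Loewner-Heinz inequality *)

Section Loewner.
Variable R : realType.
Local Notation C := R[i].
Local Opaque posdef mpow mxadj.

(** The order of [C] requires differences to be real and nonnegative, so this says that [Y - X] is
    positive semidefinite. *)
Definition loewner_le n (X Y : 'M[C]_n) := forall x, qf X x <= qf Y x.
Local Notation "X <=L Y" := (loewner_le X Y) (at level 70).

Lemma loewner_le_trans n (Y X Z : 'M[C]_n) : X <=L Y -> Y <=L Z -> X <=L Z.
Proof. by move=> h k x; exact: le_trans (h x) (k x). Qed.

Lemma loewner_leZ n (X Y : 'M[C]_n) (c : R) : 0 <= c ->
  X <=L Y -> rC c *: X <=L rC c *: Y.
Proof. by move=> c0 h x; rewrite !qfZ ler_wpM2l ?rC_le. Qed.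

Lemma loewner_le_congr m n (T : 'M[C]_(m, n)) X Y : X <=L Y ->
  mxadj T *m X *m T <=L mxadj T *m Y *m T.
Proof. by move=> h x; rewrite !qf_congr. Qed.

Lemma loewner_le_congr_herm n (T X Y : 'M[C]_n) : mxadj T = T -> X <=L Y ->
  T *m X *m T <=L T *m Y *m T.
Proof. by move=> hT /(loewner_le_congr T); rewrite hT. Qed.

Lemma qf1_mpow n (A : 'M[C]_n) s x : posdef A ->
  qf 1%:M (mpow A (s / 2) *m x) = qf (mpow A s) x.
Proof. by move=> pA; rewrite -qf_congr (mpow_adj _ pA) mulmx1 (mpow_half_sq _ pA). Qed.

Lemma spectral_form_le n (U : 'M[C]_n) (d : 'rV[R]_n) c : U *m mxadj U = 1%:M ->
  (forall i, d 0 i <= c) -> spectral_form U d <=L rC c *: 1%:M.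
Proof.
move=> UU dc x.
have -> : qf (rC c *: 1%:M) x = rC c * qf 1%:M (mxadj U *m x).
  by rewrite qfZ -qf_congr mxadjK mulmx1 UU.
rewrite /spectral_form -[X in X *m _ *m _]mxadjK qf_congr.
rewrite qf_rdiag qf1E mulr_sumr; apply: ler_sum => i _.
by rewrite ler_wpM2r ?rC_le// exprn_ge0.
Qed.

(** Congruence by [B^(-1/2)] turns the claim into a bound on the spectrum of [B^(-1/2) A B^(-1/2)],
    which consists of the eigenvalues of the pencil. Order relations thus reduce to a computation
    with one eigenvector. *)
Lemma pencil_le n (A B : 'M[C]_n) c : posdef A -> posdef B ->
  (forall m (y : 'cV_n), y != 0 -> A *m y = rC m *: (B *m y) -> m <= c) ->
  A <=L rC c *: B.
Proof.
move=> pA pB hm.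
have hk := mpowVK 2^-1 pB; have kh := mpowKV 2^-1 pB.
have hh := mpow_adj (- 2^-1) pB; have kk := mpow_adj 2^-1 pB.
have BE : mpow B 2^-1 *m mpow B 2^-1 = B by rewrite -div1r (mpow_half_sq _ pB) mpow1.
move: (mpow B _) (mpow B _) BE hk kh hh kk => h k BE hk kh hh kk.
have pM := posdef_congr_herm pA hh kh.
have ME : k *m (h *m A *m h) *m k = A.
  by rewrite !mulmxA kh mul1mx -mulmxA hk mulmx1.
have [[V d]/= [sM d0]] := posdef_spec_dec pM; have [VV V'V eM] := spec_decE sM.
suff : h *m A *m h <=L rC c *: 1%:M.
  move/(loewner_le_congr_herm kk).
  by rewrite ME -scalemxAr -scalemxAl mulmx1 BE.
rewrite eM; apply: spectral_form_le => // i.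
(* An eigenvector [v] of [h A h] gives the pencil eigenvector [h v]; here [h = B^(-1/2)] and
   [k = B^(1/2)]. *)
apply: (hm _ (h *m col i V)).
  apply/eqP => e; move/negP: (col_neq0 i V'V); apply; apply/eqP.
  by rewrite -[col i V]mul1mx -kh -mulmxA e mulmx0.
have -> : B *m (h *m col i V) = k *m col i V.
  by rewrite -BE mulmxA -(mulmxA k) kh mulmx1.
have -> : A *m (h *m col i V) = k *m (h *m A *m h *m col i V).
  by rewrite !mulmxA kh mul1mx.
rewrite eM mulmx_col /spectral_form -mulmxA V'V mulmx1 scalemxAr.
congr (_ *m _); apply/matrixP => a b; rewrite /rdiag mul_mx_diag !mxE.
by rewrite mulrC.
Qed.

(** If [B^-1 y = m A^-1 y], then [z = A^-1 y] satisfies [A z = m B z], and the hypothesis at [z]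
    bounds [m]. *)
Lemma loewner_le_inv n (A B : 'M[C]_n) c : posdef A -> posdef B ->
  A <=L rC c *: B -> mpow B (- 1) <=L rC c *: mpow A (- 1).
Proof.
move=> pA pB h; apply: pencil_le; [exact: mpow_posdef..|] => m y y0 e.
have AK : A *m mpow A (- 1) = 1%:M by rewrite -{1}(mpow1 pA) mpowKV.
have BK : B *m mpow B (- 1) = 1%:M by rewrite -{1}(mpow1 pB) mpowKV.
set z := mpow A (- 1) *m y.
have yz : A *m z = y by rewrite /z mulmxA AK mul1mx.
have z0 : z != 0 by apply: contra_neq y0 => z0; rewrite -yz z0 mulmx0.
have zB : y = rC m *: (B *m z).
  by rewrite scalemxAr /z -e mulmxA BK mul1mx.
have := h z; rewrite qfZ.
have -> : qf A z = rC m * qf B z.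
  by rewrite /qf -mulmxA yz zB -scalemxAr mxE mulmxA.
by rewrite ler_pM2r ?rC_le//; exact: posdef_qf.
Qed.

(** The core of Loewner-Heinz. Let [u = (s + t) / 2] and [A^u y = m B^u y]. As [A^s <= B^s], the
    matrix [B^(-s/2) A^(s/2)] is a contraction, and it sends [A^(t/2) y] to [m B^(t/2) y]. Comparing
    squared norms and using [A^t <= B^t] gives [m^2 <= 1]. *)
Lemma mpow_le_midpoint n (A B : 'M[C]_n) s t : posdef A -> posdef B ->
  mpow A s <=L mpow B s -> mpow A t <=L mpow B t ->
  mpow A ((s + t) / 2) <=L mpow B ((s + t) / 2).
Proof.
move=> pA pB hs ht; rewrite -[mpow B (_ / _)]scale1r -rC1.
apply: pencil_le; [exact: mpow_posdef..|] => m y y0.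
have q0 : 0 < qf (mpow B t) y := posdef_qf (mpow_posdef t pB) y0.
have hA : mpow A (s / 2) *m mpow A (t / 2) = mpow A ((s + t) / 2).
  by apply: (mpowDE pA); rewrite mulrDl.
have hB : mpow B (- s / 2) *m mpow B ((s + t) / 2) = mpow B (t / 2).
  by apply: (mpowDE pB); field.
have hAs : mpow A (s / 2) *m mpow A (- s) *m mpow A (s / 2) = 1%:M.
  rewrite (mpowDE (u := - s / 2) pA); last by field.
  by rewrite (mpowDE (u := 0) pA) ?mpow0//; field.
have hs' : mpow B (- s) <=L mpow A (- s).
  rewrite -mulrN1 -(mpowM _ _ pA) -(mpowM _ _ pB) -[mpow (mpow A s) _]scale1r -rC1.
  by apply: loewner_le_inv; [exact: mpow_posdef..|rewrite rC1 scale1r].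
have qB w : qf 1%:M (mpow B (- s / 2) *m (mpow A (s / 2) *m w)) <= qf 1%:M w.
  rewrite (qf1_mpow _ _ pB) -qf_congr -[in qf 1%:M _]hAs.
  rewrite (mpow_adj _ pA).
  exact: loewner_le_congr_herm (mpow_adj _ pA) hs' w.
move: (ht y) q0; rewrite -(qf1_mpow t y pA) -(qf1_mpow t y pB) => {}ht q0.
move: (mpow A (s / 2)) (mpow B (- s / 2)) hA hB qB => As Bs <-.
move: (mpow A (t / 2)) (mpow B (t / 2)) (mpow B ((s + t) / 2)) ht q0.
move=> At Bt Bu ht q0 BE qB e.
have e2 : Bs *m (As *m (At *m y)) = rC m *: (Bt *m y).
  by rewrite (mulmxA As) e -scalemxAr mulmxA BE.
have := le_trans (qB (At *m y)) ht; rewrite e2.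
move: (Bt *m y) q0 => z q0.
have -> : qf 1%:M (rC m *: z) = rC (m ^+ 2) * qf 1%:M z.
  by rewrite /qf mxadjZ !mulmx1 -scalemxAl -scalemxAr !mxE expr2 rCM mulrA.
rewrite -[leRHS]mul1r ler_pM2r// -rC1 rC_le => m2.
by nra.
Qed.

Lemma mpow_le_dyadic n (A B : 'M[C]_n) k j : posdef A -> posdef B -> A <=L B ->
  (j <= 2 ^ k)%N -> mpow A (j%:R / 2 ^+ k) <=L mpow B (j%:R / 2 ^+ k).
Proof.
move=> pA pB AB; elim: k j => [|k IH] j.
  rewrite expr0 divr1; case: j => [|[|//]] _.
    by rewrite (mpow0 pA) (mpow0 pB) => x.
  by rewrite (mpow1 pA) (mpow1 pB).
rewrite expnS mul2n => jk.
have j1 : (j./2 <= 2 ^ k)%N by rewrite leq_half_double (leq_trans jk) ?leqnSn.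
have j2 : (uphalf j <= 2 ^ k)%N by rewrite leq_uphalf_double.
(* [j / 2^(k+1)] is the midpoint of two dyadics of level [k], whose numerators are [j / 2] rounded
   down and up. *)
have hj : (j./2%:R / 2 ^+ k + (uphalf j)%:R / 2 ^+ k) / 2 = j%:R / 2 ^+ k.+1 :> R.
  rewrite -mulrDl -natrD uphalf_half addnCA addnn odd_double_half.
  by rewrite exprSr invfM mulrA.
rewrite -hj.
exact: mpow_le_midpoint (IH _ j1) (IH _ j2).
Qed.

Lemma ge0_dyadic_dense (f : R -> R) : continuous f ->
  (forall k j, (j <= 2 ^ k)%N -> 0 <= f (j%:R / 2 ^+ k)) ->
  forall s : R, 0 <= s <= 1 -> 0 <= f s.
Proof.
move=> cf f0 s /andP[s0 s1]; rewrite leNgt; apply/negP => fs.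
have [e/= e0 he] := cvgr_lt (f s) (cf s) _ fs.
have [k ke] : exists k, (2 ^+ k)^-1 < e.
  exists (Num.bound e^-1); rewrite -[ltRHS]invrK ltf_pV2 ?posrE ?invr_gt0 ?exprn_gt0//.
  rewrite (lt_le_trans (archi_boundP _)) ?invr_ge0 ?(ltW e0)// -natrX ler_nat.
  exact/ltnW/ltn_expl.
have p0 : 0 < 2 ^+ k :> R by rewrite exprn_gt0.
(* Rounding [s] down to a multiple of [2^-k] keeps [j <= 2^k] and stays within [e] of [s], where [f]
   is still negative. *)
set j := Num.truncn (s * 2 ^+ k).
have /andP[j1 j2] : j%:R <= s * 2 ^+ k < j.+1%:R.
  by apply: truncn_itv; rewrite mulr_ge0// ltW.
have jk : (j <= 2 ^ k)%N.
  rewrite -(ler_nat R) natrX (le_trans j1)//.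
  by rewrite ler_piMl// ltW.
have /he/= : ball s e (j%:R / 2 ^+ k).
  rewrite /ball/= (le_lt_trans _ ke)// ger0_norm ?subr_ge0 ?ler_pdivrMr//.
  rewrite lerBlDr -[X in X + _]mul1r -mulrDl ler_pdivlMr//.
  by rewrite nat1r ltW.
by rewrite ltNge f0.
Qed.

Lemma continuous_sumr (I : Type) (r : seq I) (F : I -> R -> R) :
  (forall i, continuous (F i)) -> continuous (fun s => \sum_(i <- r) F i s).
Proof.
move=> cF; elim: r => [|i r IH].
  have -> : (fun s => \sum_(i <- [::]) F i s) = fun=> 0.
    by apply/funext => s; rewrite big_nil.
  by move=> s; exact: cvg_cst.
have -> : (fun s => \sum_(i <- i :: r) F i s) = fun s => F i s + \sum_(i <- r) F i s.
  by apply/funext => s; rewrite big_cons.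
by move=> s; apply: cvgD; [exact: cF | exact: IH].
Qed.

Lemma qf_mpow_continuous n (A : 'M[C]_n) x : posdef A ->
  exists2 f : R -> R, continuous f & forall s, qf (mpow A s) x = rC (f s).
Proof.
move=> /posdef_spec_dec[[U d]/= [sA d0]].
(* Writing powers of eigenvalues as exponentials makes continuity in the exponent immediate. *)
exists (fun s => \sum_i expR (s * ln (d 0 i)) *
  complex.Re (`|(mxadj U *m x) i 0| ^+ 2)).
  apply: continuous_sumr => i.
  have cE : continuous (@expR R \o *%R^~ (ln (d 0 i))).
    move=> s; apply: continuous_comp; first exact: mulrr_continuous.
    exact: continuous_expR.
  by move=> s; apply: cvgM; [exact: cE | exact: cvg_cst].
move=> s; rewrite (mpowE s sA d0) /spectral_form -[X in X *m _ *m _]mxadjK.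
rewrite qf_congr qf_rdiag rC_sum; apply: eq_bigr => i _.
rewrite rCM mxE /powR (gt_eqF (d0 i)); congr (_ * _).
by rewrite -[RHS]/((complex.Re _)%:C)%C RRe_real// realX.
Qed.

(** Exponents preserving the order include 0 and 1 and are closed under midpoints, hence include all
    dyadics of the unit interval; continuity in the exponent does the rest. *)
Lemma loewner_heinz n (A B : 'M[C]_n) s : posdef A -> posdef B -> 0 <= s <= 1 ->
  A <=L B -> mpow A s <=L mpow B s.
Proof.
move=> pA pB s01 AB x.
have [f cf fE] := qf_mpow_continuous x pA.
have [g cg gE] := qf_mpow_continuous x pB.
rewrite fE gE rC_le -subr_ge0; apply: (@ge0_dyadic_dense (fun s => g s - f s)) => //.
  by move=> t; apply: cvgB; [exact: cg | exact: cf].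
move=> k j jk; rewrite subr_ge0 -rC_le -fE -gE.
exact: mpow_le_dyadic.
Qed.

Lemma loewner_heinzZ n (A B : 'M[C]_n) c s : posdef A -> posdef B ->
  0 <= s <= 1 -> 0 < c -> A <=L rC c *: B -> mpow A s <=L rC (c `^ s) *: mpow B s.
Proof.
move=> pA pB s01 c0 h; rewrite -(mpowZ _ c0 pB).
exact: loewner_heinz pA (posdefZ c0 pB) s01 h.
Qed.

End Loewner.

(** * The operator inequality behind the comparison of largest eigenvalues *)

Section OperatorInequality.
Variable R : realType.
Local Notation C := R[i].
Local Notation "X <=L Y" := (loewner_le X Y) (at level 70).
Local Opaque posdef mpow mxadj.

Lemma mpow2 n (A : 'M[C]_n) : posdef A -> mpow A 2 = A *m A.
Proof. by move=> pA; rewrite -(mpowDE (s := 1) (t := 1) pA)// mpow1. Qed.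

Lemma mpow_sq n (A : 'M[C]_n) : posdef A -> mpow (A *m A) 2^-1 = A.
Proof.
move=> pA; rewrite -(mpow2 pA) (mpowME (u := 1) pA) ?mpow1//.
by rewrite divff// pnatr_eq0.
Qed.

Lemma posdef_sq n (A : 'M[C]_n) : posdef A -> posdef (A *m A).
Proof. by move=> pA; rewrite -(mpow2 pA); exact: mpow_posdef. Qed.

(** The chain of inequalities from the overview, for arbitrary [c]. With [B = H K H] one has
    [Q = B^(p/2)], and each use of Loewner-Heinz raises the constant to the same exponent as the
    matrices. *)
Lemma mpow_le_of_congr n (K H : 'M[C]_n) (s c : R) :
  posdef K -> posdef H -> 0 <= s <= 2^-1 -> 0 < c ->
  mpow (H *m K *m H) s <=L rC c *: mpow K (1 + s) ->
  mpow H (2 * s) <=L rC c *: K.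
Proof.
move=> pK pH /andP[s0 s2] c0.
have s1 : 1 + s != 0 by rewrite gt_eqF// ltr_pwDl.
have hH := posdef_adj pH.
have VH : mpow H (- 1) *m H = 1%:M by rewrite -{2}(mpow1 pH) mpowVK.
have HV : H *m mpow H (- 1) = 1%:M by rewrite -{1}(mpow1 pH) mpowKV.
have := posdef_congr_herm pK hH VH.
have [B BE] : exists B, H *m K *m H = B by exists (H *m K *m H).
rewrite BE => pB h.
pose p := (1 + s)^-1.
have p01 : 0 <= p <= 1.
  by rewrite invr_ge0 addr_ge0//= invf_le1 ?ltr_pwDl// lerDl.
(* In terms of the overview, [Q^s = B^a], [Q^(2s) = B^(2a)] and [Q = B^(1/2 - a)]. *)
have [a aE] : exists a, 2 * a = s * p by exists (s * p / 2); field.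
have apE : 2^-1 - a = p / 2 :> R.
  by have -> : a = s * p / 2; [rewrite -aE; field | rewrite /p; field].
(* The constant [g = c^p] comes from Loewner-Heinz with exponent [p]; since [p (1 + s) = 1], [g^s g]
   is again [c]. *)
have [g g0 [gE hg]] : exists2 g : R, 0 < g &
    g `^ s * g = c /\ mpow B (2 * a) <=L rC g *: K.
  exists (c `^ p); first exact: powR_gt0.
  split.
    rewrite -powRrM -powRD ?(gt_eqF c0) ?implybT// -[X in _ + X]mul1r mulrC -mulrDl.
    by rewrite addrC divff// powRr1// ltW.
  have := loewner_heinzZ (mpow_posdef s pB) (mpow_posdef (1 + s) pK) p01 c0 h.
  by rewrite (mpowM _ _ pB) -aE (mpowME (u := 1) pK) ?(mpow1 pK)// divff.
have h1 : H *m mpow B (2 * a) *m H <=L rC g *: B.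
  by have := loewner_le_congr_herm hH hg; rewrite -scalemxAr -scalemxAl BE.
(* Conjugating [h1] by [B^a] makes its left side the square of [B^a H B^a]; a square root followed
   by conjugation with [B^(-a)] isolates [H]. *)
have h2 : H <=L rC (g `^ 2^-1) *: mpow B (p / 2).
  have aa : mpow B a *m mpow B a = mpow B (2 * a).
    by apply: (mpowDE pB); rewrite mulrDl mul1r.
  have aB : mpow B a *m B *m mpow B a = mpow B (1 + 2 * a).
    by rewrite -{2}(mpow1 pB) (mpowD _ _ pB); apply: (mpowDE pB); ring.
  have pM := posdef_congr_herm pH (mpow_adj a pB) (mpowVK a pB).
  have hM := loewner_le_congr_herm (mpow_adj a pB) h1.
  have {hM} : mpow B a *m H *m mpow B a *m (mpow B a *m H *m mpow B a)
      <=L rC g *: mpow B (1 + 2 * a).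
    by move: hM; rewrite -scalemxAr -scalemxAl aB -aa !mulmxA.
  have half01 : 0 <= (2^-1 : R) <= 1 by lra.
  have := loewner_le_congr_herm (mpow_adj (- a) pB).
  have := mpowVK a pB; have := mpowKV a pB.
  have bE : mpow B (- a) *m mpow (mpow B (1 + 2 * a)) 2^-1 *m mpow B (- a) =
      mpow B (p / 2).
    rewrite (mpowM _ _ pB) (mpowD _ _ pB); apply: (mpowDE pB).
    by rewrite -apE; field.
  move: (mpow B a) (mpow B (- a)) pM bE => b b' pM bE bb' b'b cong hM.
  have := cong _ _ (loewner_heinzZ (posdef_sq pM) (mpow_posdef _ pB) half01 g0 hM).
  rewrite (mpow_sq pM) -scalemxAr -scalemxAl bE !mulmxA b'b mul1mx -mulmxA bb' mulmx1.
  exact.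
(* Loewner-Heinz with exponent [2 * s], at most 1 because [s <= 1/2]. *)
have h3 : mpow H (2 * s) <=L rC (g `^ s) *: mpow B (2 * a).
  have s01 : 0 <= 2 * s <= 1 by lra.
  have := loewner_heinzZ pH (mpow_posdef _ pB) s01 (powR_gt0 2^-1 g0) h2.
  have -> : (g `^ 2^-1) `^ (2 * s) = g `^ s by rewrite -powRrM; congr powR; field.
  rewrite (mpowME (u := 2 * a) pB); first exact.
  by rewrite aE; field.
have h4 : H *m mpow H (2 * s) *m H <=L rC c *: B.
  apply: loewner_le_trans (loewner_le_congr_herm hH h3) _.
  rewrite -scalemxAr -scalemxAl -gE rCM -scalerA.
  by apply: loewner_leZ h1; exact: powR_ge0.
have := loewner_le_congr_herm (mpow_adj (- 1) pH) h4.
move: (mpow H (- 1)) VH HV => V VH HV.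
rewrite -BE -scalemxAr -scalemxAl !mulmxA VH !mul1mx -!mulmxA HV !mulmx1.
exact.
Qed.

Lemma mpow_congr_le1 n (A X : 'M[C]_n) a u c : posdef A -> a + a + u = 0 ->
  (mpow A a *m X *m mpow A a <=L rC c *: 1%:M) <-> (X <=L rC c *: mpow A u).
Proof.
move=> pA au; have uE : u = - a + - a.
  by rewrite -opprD -[RHS]add0r -au addrAC subrr add0r.
have uM : mpow A (- a) *m mpow A (- a) = mpow A u by apply: (mpowDE pA).
have hV := mpow_adj (- a) pA; have hT := mpow_adj a pA.
move: uM (mpowVK a pA) (mpowKV a pA) hV hT.
move: (mpow A a) (mpow A (- a)) => T V <- VT TV hV hT; split.
  move/(loewner_le_congr_herm hV).
  by rewrite -scalemxAr -scalemxAl mulmx1 !mulmxA VT mul1mx -mulmxA TV mulmx1.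
move/(loewner_le_congr_herm hT).
by rewrite -scalemxAr -scalemxAl !mulmxA TV mul1mx VT.
Qed.

(** With [T = B^b A^a] the two products are [T^* T] and [T T^*], which share their largest
    eigenvalue; the proof inverts [B^(2b) <= c A^(-2a)]. *)
Lemma mpow_congr_le1_swap n (A B : 'M[C]_n) a b c : posdef A -> posdef B ->
  mpow A a *m mpow B (b + b) *m mpow A a <=L rC c *: 1%:M ->
  mpow B b *m mpow A (a + a) *m mpow B b <=L rC c *: 1%:M.
Proof.
move=> pA pB /(mpow_congr_le1 _ _ pA (subrr (a + a))) h.
apply/(mpow_congr_le1 _ _ pB (subrr (b + b))).
have := loewner_le_inv (mpow_posdef _ pB) (mpow_posdef _ pA) h.
by rewrite (mpowM _ _ pA) (mpowM _ _ pB) !mulrN1 opprK.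
Qed.

(** By congruence the hypothesis becomes [(H K H)^s <= c K^(1+s)] with [K = A^-1] and [H = G^-1].
    The resulting [H^(2s) <= c K] is inverted to [A <= c G^(2s)], which is the conclusion up to
    congruence. *)
Lemma spectral_gmean_le_neg n (A G : 'M[C]_n) (s c : R) : posdef A -> posdef G ->
  0 <= s <= 2^-1 -> 0 < c ->
  mpow A ((1 + s) / 2) *m mpow (G *m A *m G) (- s) *m mpow A ((1 + s) / 2)
    <=L rC c *: 1%:M ->
  mpow G (- s) *m A *m mpow G (- s) <=L rC c *: 1%:M.
Proof.
move=> pA pG s01 c0.
have VG : mpow G (- 1) *m G = 1%:M by rewrite -{2}(mpow1 pG) mpowVK.
have GV : G *m mpow G (- 1) = 1%:M by rewrite -{1}(mpow1 pG) mpowKV.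
have AV : A *m mpow A (- 1) = 1%:M by rewrite -{1}(mpow1 pA) mpowKV.
have pB := posdef_congr_herm pA (posdef_adj pG) VG.
have VB : mpow (G *m A *m G) (- 1) *m (G *m A *m G) = 1%:M.
  by rewrite -{2}(mpow1 pB) mpowVK.
have e1 : (1 + s) / 2 + (1 + s) / 2 + (- 1) * (1 + s) = 0 by field.
move=> /(mpow_congr_le1 _ _ pA e1) h.
have BV : mpow (G *m A *m G) (- 1) = mpow G (- 1) *m mpow A (- 1) *m mpow G (- 1).
  move: (mpow (_ *m _) _) (mpow G _) (mpow A _) VB GV AV => W V V' VB GV AV.
  have K : G *m A *m G *m (V *m V' *m V) = 1%:M.
    by rewrite !mulmxA -(mulmxA _ G V) GV mulmx1 -(mulmxA _ A V') AV mulmx1.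
  by rewrite -[LHS]mulmx1 -K mulmxA VB mul1mx.
have {BV}h : mpow (mpow G (- 1) *m mpow A (- 1) *m mpow G (- 1)) s
    <=L rC c *: mpow (mpow A (- 1)) (1 + s).
  by rewrite -BV (mpowM _ _ pA) (mpowM _ _ pB) mulN1r.
have {}h := mpow_le_of_congr (mpow_posdef _ pA) (mpow_posdef _ pG) s01 c0 h.
have e2 : - s + - s + 2 * s = 0 by ring.
apply: (mpow_congr_le1 A c pG e2).2.
have := loewner_le_inv (mpow_posdef _ (mpow_posdef _ pG)) (mpow_posdef _ pA) h.
rewrite (mpowM _ _ pA) (mpowM _ _ (mpow_posdef _ pG)) (mpowM _ _ pG).
rewrite mulN1r opprK (mpow1 pA).
by have -> : - 1 * (2 * s * - 1) = 2 * s by ring.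
Qed.

Lemma spectral_gmean_le n (A B G : 'M[C]_n) (t c : R) :
  posdef A -> posdef B -> posdef G -> G *m A *m G = B ->
  (- 2^-1 <= t <= 0) \/ (1 <= t <= 3 / 2) -> 0 < c ->
  mpow A ((1 - t) / 2) *m mpow B t *m mpow A ((1 - t) / 2) <=L rC c *: 1%:M ->
  mpow G t *m A *m mpow G t <=L rC c *: 1%:M.
Proof.
move=> pA pB pG GE [/andP[t0 t1]|/andP[t0 t1]] c0.
  have s01 : 0 <= - t <= 2^-1 by lra.
  by have := spectral_gmean_le_neg pA pG s01 c0; rewrite GE !opprK.
(* For [t >= 1] exchange [A] and [B]: then [G^-1] solves the Riccati equation and the exponent
   [1 - t] lies in [[-1/2, 0]]. *)
have s01 : 0 <= t - 1 <= 2^-1 by lra.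
have VG : mpow G (- 1) *m G = 1%:M by rewrite -{2}(mpow1 pG) mpowVK.
have GV : G *m mpow G (- 1) = 1%:M by rewrite -{1}(mpow1 pG) mpowKV.
have AE : mpow G (- 1) *m B *m mpow G (- 1) = A.
  move: (mpow G _) VG GV => V VG GV.
  by rewrite -GE !mulmxA VG mul1mx -mulmxA GV mulmx1.
move=> h.
have {}h : mpow A ((1 - t) / 2) *m mpow B (t / 2 + t / 2) *m mpow A ((1 - t) / 2)
    <=L rC c *: 1%:M by rewrite -splitr.
have {}h := mpow_congr_le1_swap pA pB h.
have e1 : 1 + (t - 1) = t by ring.
have {}h : mpow B ((1 + (t - 1)) / 2) *m mpow A (- (t - 1)) *m
    mpow B ((1 + (t - 1)) / 2) <=L rC c *: 1%:M.
  by rewrite e1 opprB (splitr (1 - t)).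
rewrite -AE in h.
have {h} := spectral_gmean_le_neg pB (mpow_posdef (- 1) pG) s01 c0 h.
have -> : mpow (mpow G (- 1)) (- (t - 1)) = mpow G (t - 1).
  by apply: (mpowME pG); ring.
have XE : mpow G (t - 1) *m mpow G 1 = mpow G t by apply: (mpowDE pG); ring.
have XE' : mpow G 1 *m mpow G (t - 1) = mpow G t by apply: (mpowDE pG); ring.
have -> : mpow G t *m A *m mpow G t = mpow G (t - 1) *m B *m mpow G (t - 1).
  rewrite (mpow1 pG) in XE XE'; move: (mpow G t) (mpow G (t - 1)) XE XE' => X Y XE XE'.
  by rewrite -{1}XE -XE' -GE !mulmxA.
exact.
Qed.

End OperatorInequality.

(** * Tensor powers of matrices and the antisymmetrizer *)

Section TensorPower.
Variables (R : realType) (n k : nat).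
Local Notation C := R[i].
Local Notation idx := {ffun 'I_k -> 'I_n}.
Local Notation N := #|{: idx}|.

(** The standard basis of the tensors of rank [k] is labelled by multi-indices, which [enum_val]
    numbers by ordinals. *)
Definition idxmx (F : idx -> idx -> C) : 'M[C]_N :=
  \matrix_(i, j) F (enum_val i) (enum_val j).

Lemma idxmxM F G : idxmx F *m idxmx G = idxmx (fun f g => \sum_h F f h * G h g).
Proof.
apply/matrixP => i j; rewrite !mxE [RHS](reindex _ (onW_bij _ (enum_val_bij _)))/=.
by apply: eq_bigr => l _; rewrite !mxE.
Qed.

Lemma eq_idxmx F G : (forall f g, F f g = G f g) -> idxmx F = idxmx G.
Proof. by move=> FG; apply/matrixP => i j; rewrite !mxE. Qed.

(** The [k]-th Kronecker power. *)
Definition tens (X : 'M[C]_n) : 'M[C]_N :=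
  idxmx (fun f g => \prod_a X (f a) (g a)).

Lemma tensM X Y : tens (X *m Y) = tens X *m tens Y.
Proof.
rewrite idxmxM; apply: eq_idxmx => f g.
under eq_bigr do rewrite mxE.
rewrite bigA_distr_bigA; apply: eq_bigr => h _.
by rewrite big_split.
Qed.

Definition tens_row (d : 'rV[R]_n) : 'rV[R]_N :=
  \row_i \prod_a d 0 ((enum_val i : idx) a).

Lemma tens_rdiag (d : 'rV[R]_n) :
  tens (rdiag d) = rdiag (tens_row d).
Proof.
apply/matrixP => i j; rewrite rdiagE !mxE.
have [->|/eqP ij] := eqVneq i j.
  by rewrite rC_prod; apply: eq_bigr => a _; rewrite rdiagE eqxx.
have [a fga] : exists a, (enum_val i : idx) a != (enum_val j : idx) a.
  apply/existsP; rewrite -negb_forall; apply/negP => /forallP h.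
  by apply/ij/enum_val_inj/ffunP => a; exact/eqP.
by rewrite (bigD1 a)//= rdiagE (negPf fga) mul0r.
Qed.

Lemma rdiag1 m : rdiag (const_mx 1 : 'rV[R]_m) = 1%:M.
Proof. by apply/matrixP => i j; rewrite rdiagE !mxE rC1. Qed.

Lemma tens1 : tens 1%:M = 1%:M.
Proof.
rewrite -rdiag1 tens_rdiag -[RHS]rdiag1; congr rdiag.
by apply/rowP => i; rewrite !mxE big1// => a _; rewrite mxE.
Qed.

Lemma tens_adj X : tens (mxadj X) = mxadj (tens X).
Proof.
apply/matrixP => i j; rewrite mxadjE !mxE rmorph_prod.
by apply: eq_bigr => a _; rewrite mxadjE.
Qed.

Lemma tens_unitary U : U *m mxadj U = 1%:M -> tens U *m mxadj (tens U) = 1%:M.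
Proof. by move=> UU; rewrite -tens_adj -tensM UU tens1. Qed.

Lemma tens_spectral_form U (d : 'rV[R]_n) : tens (spectral_form U d) =
  spectral_form (tens U) (tens_row d).
Proof. by rewrite /spectral_form !tensM tens_adj tens_rdiag. Qed.

Lemma tens_posdef X : posdef X -> posdef (tens X).
Proof.
move=> /posdef_spec_dec[[U d]/= [sX d0]]; have [UU _ ->] := spec_decE sX.
rewrite tens_spectral_form; apply: posdef_spectral_form; first exact: tens_unitary.
by move=> i; rewrite mxE prodr_gt0.
Qed.

Lemma tens_mpow X s : posdef X -> tens (mpow X s) = mpow (tens X) s.
Proof.
move=> /posdef_spec_dec[[U d]/= [sX d0]]; have [UU _ eX] := spec_decE sX.
have sT : spec_dec (tens X) (tens U) (tens_row d).
  by split; [exact: tens_unitary | rewrite eX tens_spectral_form].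
rewrite (mpowE s sX d0) (mpowE s sT) => [|i]; last by rewrite mxE prodr_gt0.
rewrite tens_spectral_form; congr spectral_form; apply/rowP => i.
rewrite !mxE powR_prod => [|a]; last exact: ltW.
by apply: eq_bigr => a _; rewrite mxE.
Qed.

Definition idxperm (f : idx) (s : 'S_k) : idx := [ffun a => f (s a)].

Lemma idxpermK f s : idxperm (idxperm f s) s^-1%g = f.
Proof. by apply/ffunP => a; rewrite !ffunE permKV. Qed.

Lemma idxpermKV f s : idxperm (idxperm f s^-1%g) s = f.
Proof. by apply/ffunP => a; rewrite !ffunE permK. Qed.

(** This is [k!] times the orthogonal projection onto the antisymmetric tensors. *)
Definition antisym : 'M[C]_N :=
  idxmx (fun f g => \sum_(s : 'S_k) (-1) ^+ s * (g == idxperm f s)%:R).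

(** Permuting the tensor factors commutes with applying the same [X] to each of them. *)
Lemma antisym_comm X : antisym *m tens X = tens X *m antisym.
Proof.
rewrite !idxmxM; apply: eq_idxmx => f g.
under eq_bigr do rewrite mulr_suml.
under [RHS]eq_bigr do rewrite mulr_sumr.
rewrite exchange_big/= [RHS]exchange_big/=; apply: eq_bigr => s _.
rewrite (bigD1 (idxperm f s))//=.
rewrite [X in _ + X = _]big1 ?addr0 => [|h /negPf ->]; last first.
  by rewrite mulr0 mul0r.
rewrite (bigD1 (idxperm g s^-1%g))//=.
rewrite [X in _ = _ + X]big1 ?addr0 => [|h hg]; last first.
  case: eqP => [gh|]; last by rewrite !mulr0.
  by rewrite gh idxpermK eqxx in hg.
rewrite idxpermKV !eqxx !mulr1 mulrC; congr (_ * _).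
rewrite [RHS](reindex_inj (@perm_inj _ s)).
by apply: eq_bigr => a _; rewrite !ffunE permK.
Qed.

(** A multi-index with a repetition is fixed by a transposition, which flips every sign, so the sum
    equals its own opposite. *)
Lemma antisym_row0 i j : ~~ injectiveb (enum_val i : idx) -> antisym i j = 0.
Proof.
move=> /injectivePn[a [b ab fab]]; rewrite mxE; set f := enum_val i in fab *.
have fE s : idxperm f (s * tperm a b)%g = idxperm f s.
  apply/ffunP => c; rewrite !ffunE permM.
  by case: tpermP => [->|->|].
set S := LHS.
suff : S = - S by move=> /eqP; rewrite -addr_eq0 -mulr2n mulrn_eq0 => /eqP.
rewrite /S [LHS](reindex_inj (mulIg (tperm a b))) -sumrN; apply: eq_bigr => s _ /=.
by rewrite fE odd_permM odd_tperm ab signr_addb mulrN1 mulNr.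
Qed.

Lemma antisym_col i j : antisym i j != 0 ->
  exists s, enum_val i = idxperm (enum_val j) s.
Proof.
rewrite mxE => nz; apply: contrapT => /forallNP h; move/negP: nz; apply.
apply/eqP/big1 => s _; case: eqP => [e|]; last by rewrite mulr0.
by case: (h s^-1%g); rewrite e idxpermK.
Qed.

Lemma antisym_diag i : injective (enum_val i : idx) -> antisym i i = 1.
Proof.
move=> inj; rewrite mxE (bigD1 1%g)//= big1 => [|s s1].
  rewrite odd_perm1 expr0 addr0 mul1r (_ : _ == _)//.
  by apply/eqP/ffunP => a; rewrite !ffunE perm1.
case: eqP => [e|]; last by rewrite mulr0.
case/eqP: s1; apply/permP => a; rewrite perm1; apply: inj.
by move/ffunP/(_ a): e; rewrite ffunE.
Qed.

End TensorPower.

(** * Products of the largest terms of a nonincreasing sequence *)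

Section TopProduct.
Variables (R : realType) (n : nat) (d : 'I_n -> R).
Hypothesis d_ge0 : forall i, 0 <= d i.
Hypothesis d_anti : forall i j : 'I_n, (i <= j)%N -> d j <= d i.

Definition top_prod k := \prod_(j < n | (j < k)%N) d j.

(** Induction on the size: the maximum [m] of a set of [k + 1] indices is at least [k], so
    [d m <= d k]; the remaining [k] indices are handled by induction. *)
Lemma prod_set_le_top (S : {set 'I_n}) : \prod_(i in S) d i <= top_prod #|S|.
Proof.
move e : #|S| => k; elim: k S e => [|k IH] S Sk.
  by rewrite (cards0_eq Sk) big_set0 /top_prod big_pred0.
have [i0 i0S] : exists i, i \in S by apply/card_gt0P; rewrite Sk.
have [m mS mmax] := arg_maxnP (fun i : 'I_n => i : nat) i0S.
have {}mS : m \in S by [].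
have {}mmax i : i \in S -> (i <= m)%N by exact: mmax.
have km : (k <= m)%N.
  rewrite -ltnS -Sk -[m.+1]card_ord.
  apply: leq_trans (leq_imset_card (widen_ord (ltn_ord m)) _).
  apply/subset_leq_card/fintype.subsetP => i iS; apply/imsetP.
  by exists (Ordinal (mmax i iS : (i < m.+1)%N)) => //; exact: val_inj.
have kn := leq_ltn_trans km (ltn_ord m).
rewrite (bigD1 m)//= /top_prod [leRHS](bigD1 (Ordinal kn))//=.
apply: ler_pM => //; [by rewrite prodr_ge0 | exact: d_anti |].
rewrite (eq_bigl (fun i => i \in S :\ m)) => [|i]; last by rewrite !inE andbC.
rewrite (eq_bigl (fun j : 'I_n => (j < k)%N)) => [|j].
  by apply: IH; move: (cardsD1 m S); rewrite mS Sk add1n => -[].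
by rewrite -(inj_eq val_inj)/= ltnS ltn_neqAle andbC.
Qed.

Lemma prod_inj_le_top k (f : 'I_k -> 'I_n) : injective f ->
  \prod_a d (f a) <= top_prod k.
Proof.
move=> inj; have := prod_set_le_top [set f a | a in 'I_k].
rewrite (card_imset _ inj) card_ord big_imset/=; last by move=> a b _ _; exact: inj.
by rewrite (eq_bigl predT).
Qed.

End TopProduct.

(** * Restriction of tensor powers to the antisymmetric tensors *)

Section Compression.
Variable R : realType.
Local Notation C := R[i].
Local Notation "X <=L Y" := (loewner_le X Y) (at level 70).

(** Gram-Schmidt applied to a basis of the column space of [P]; the two factorizations say that [J]
    and [P] have the same range. *)
Lemma range_isometry p q (P : 'M[C]_(p, q)) :
  exists r (J : 'M[C]_(p, r)) (Y : 'M[C]_(q, r)) (Z : 'M[C]_(r, q)),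
    [/\ mxadj J *m J = 1%:M, J = P *m Y & P = J *m Z].
Proof.
pose W := spectral.schmidt (row_base P^T).
have /spectral.unitarymxP WW : W \is spectral.unitarymx.
  by apply: spectral.schmidt_unitarymx; exact: rank_leq_col.
have WP : (W :=: P^T)%MS.
  apply: eqmx_trans (eq_row_base _).
  exact/spectral.eqmx_schmidt_free/row_base_free.
have /submxP[Y YE] : (W <= P^T)%MS by rewrite WP.
have /submxP[Z ZE] : (P^T <= W)%MS by rewrite WP.
exists _, W^T, Y^T, Z^T; split.
- have := congr1 (map_mx Num.conj) WW.
  rewrite map_mxM map_mx1 => <-; rewrite /mxadj; congr (_ *m _).
    by rewrite map_trmx trmxK.
  by rewrite -map_mx_comp map_mx_id// => z; exact: conjCK.
- by rewrite YE trmx_mul trmxK.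
- by rewrite -trmx_mul -ZE trmxK.
Qed.

(** The last hypothesis says that [X] preserves the range of [J]. Hence [J] intertwines [X] with its
    compression, and so intertwines their powers. *)
Lemma compression_mpow m r (X : 'M[C]_m) (J : 'M[C]_(m, r)) s :
  posdef X -> mxadj J *m J = 1%:M -> X *m J = J *m (mxadj J *m X *m J) ->
  posdef (mxadj J *m X *m J) /\
  mxadj J *m mpow X s *m J = mpow (mxadj J *m X *m J) s.
Proof.
move=> pX JJ XJ.
have pL : posdef (mxadj J *m X *m J).
  by apply: posdef_congr => //; exact: unitmx_inj JJ.
split=> //; rewrite -mulmxA (mpow_intertwine s pX pL XJ) mulmxA JJ.
exact: mul1mx.
Qed.

(* [L] plays the role of the [k]-th compound [X |-> Lambda^k X], written in an
   orthonormal basis of the antisymmetric tensors of rank [k]. *)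
Lemma compound n k : (k <= n)%N -> exists r (L : 'M[C]_n -> 'M[C]_r), [/\
  forall X Y, L (X *m Y) = L X *m L Y,
  forall X, posdef X -> posdef (L X),
  forall X s, posdef X -> L (mpow X s) = mpow (L X) s,
  forall X U (d : 'rV[R]_n), spec_dec X U d -> (forall i, 0 <= d 0 i) ->
    (forall i j : 'I_n, (i <= j)%N -> d 0 j <= d 0 i) ->
    L X <=L rC (top_prod (d 0) k) *: 1%:M &
  forall X U (d : 'rV[R]_n) c, spec_dec X U d ->
    L X <=L rC c *: 1%:M -> top_prod (d 0) k <= c].
Proof.
move=> kn; have [r [J [Y [Z [JJ JY JZ]]]]] := range_isometry (antisym R n k).
have JP : J *m mxadj J *m antisym R n k = antisym R n k.
  by rewrite JZ mulmxA -(mulmxA J) JJ mulmx1.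
(* The range of [J] is that of the antisymmetrizer, which commutes with [tens k X], so it is
   invariant. *)
have XJ X : tens k X *m J = J *m (mxadj J *m tens k X *m J).
  rewrite [in LHS]JY mulmxA -antisym_comm -[in LHS]JP.
  rewrite -!mulmxA (mulmxA _ (tens k X)) antisym_comm.
  by rewrite -mulmxA -JY !mulmxA.
pose L X := mxadj J *m tens k X *m J.
have LM X X' : L (X *m X') = L X *m L X'.
  by rewrite /L tensM -!mulmxA [in LHS]XJ !mulmxA.
have L1 : L 1%:M = 1%:M by rewrite /L tens1 mulmx1.
have Ladj X : L (mxadj X) = mxadj (L X).
  by rewrite /L tens_adj !mxadjM mxadjK mulmxA.
have LU U : U *m mxadj U = 1%:M -> L U *m mxadj (L U) = 1%:M.
  by move=> UU; rewrite -Ladj -LM UU L1.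
have LS U (d : 'rV[R]_n) : L (spectral_form U d) =
    mxadj (mxadj (L U)) *m (mxadj J *m rdiag (tens_row k d) *m J) *m mxadj (L U).
  by rewrite mxadjK /spectral_form !LM Ladj {2}/L tens_rdiag.
exists r, L; split=> //.
- by move=> X pX; case: (compression_mpow 0 (tens_posdef k pX) JJ (XJ X)).
- move=> X s pX; rewrite /L tens_mpow//.
  by case: (compression_mpow s (tens_posdef k pX) JJ (XJ X)).
(* Antisymmetric tensors vanish at multi-indices with a repetition; at the injective ones the
   diagonal entry is a product of [k] distinct eigenvalues. *)
- move=> X U d /spec_decE[UU _ ->] d0 dd x; rewrite LS qf_congr qf_congr qfZ.
  have -> : qf 1%:M x = qf 1%:M (J *m (mxadj (L U) *m x)).
    by rewrite -qf_congr mulmx1 JJ -qf_congr mxadjK mulmx1 LU.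
  rewrite qf_rdiag qf1E mulr_sumr; apply: ler_sum => i _.
  have [inj|ninj] := boolP (injectiveb (enum_val i : {ffun 'I_k -> 'I_n})).
    rewrite ler_wpM2r ?exprn_ge0// rC_le mxE.
    exact/prod_inj_le_top/injectiveP.
  suff -> : (J *m (mxadj (L U) *m x)) i 0 = 0 by rewrite normr0 expr0n !mulr0.
  rewrite JY -mulmxA mxE big1// => j _.
  by rewrite antisym_row0// mul0r.
- move=> X U d c /spec_decE[UU U'U ->] h.
  (* The bound is attained at [w], the antisymmetrization of the tensor product of the first [k]
     basis vectors. *)
  pose f0 : {ffun 'I_k -> 'I_n} := [ffun a => widen_ord kn a].
  pose j0 := enum_rank f0; pose w := col j0 (antisym R n k).
  pose v := mxadj J *m w.
  have Jv : J *m v = w by rewrite /v mulmxA mulmx_col JP.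
  have j0E : enum_val j0 = f0 by exact: enum_rankK.
  have wi i : w i 0 = antisym R n k i j0 by rewrite /w mxE.
  have w0 : w != 0.
    apply/eqP => /matrixP/(_ j0 0); rewrite wi [RHS]mxE antisym_diag.
      by move/eqP; rewrite oner_eq0.
    by rewrite j0E => a b; rewrite !ffunE => /(congr1 val)/= ab; exact: val_inj.
  have v0 : v != 0 by apply: contra_neq w0 => v0; rewrite -Jv v0 mulmx0.
  have top_prodE : top_prod (d 0) k = \prod_a d 0 (f0 a).
    rewrite /top_prod (big_ord_narrow kn).
    by apply: eq_bigr => a _; rewrite ffunE.
  (* The support of [w] consists of rearrangements of [f0], and these all give the same product of
     entries of [d]. *)
  have wE : rdiag (tens_row k d) *m w = rC (top_prod (d 0) k) *: w.
    apply/colP => i; rewrite /rdiag mul_diag_mx mxE [RHS]mxE wi.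
    have [->|/antisym_col[s sE]] := eqVneq (antisym R n k i j0) 0.
      by rewrite !mulr0.
    congr (_ * _); rewrite !mxE sE j0E top_prodE; congr rC.
    rewrite [RHS](reindex_inj (@perm_inj _ s)).
    by apply: eq_bigr => a _; rewrite ffunE.
  have := h (L U *m v); rewrite LS qf_congr (mulmxA (mxadj (L U))).
  rewrite (mulmx1C (LU U UU)) mul1mx qf_congr Jv (qf_eigen wE) qfZ.
  have -> : qf 1%:M (L U *m v) = qf 1%:M w.
    by rewrite -qf_congr mulmx1 (mulmx1C (LU U UU)) -Jv -qf_congr mulmx1 JJ.
  by rewrite ler_pM2r ?rC_le//; exact: qf1_gt0.
Qed.

End Compression.

(** * Eigenvalues in nonincreasing order *)

Section Eigenvalues.
Variable R : realType.
Local Notation C := R[i].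

Lemma sorting_perm n (d : 'rV[R]_n) :
  exists s : 'S_n, forall i j : 'I_n, (i <= j)%N -> d 0 (s j) <= d 0 (s i).
Proof.
pose t := [tuple d 0 i | i < n].
have /tuple_permP[s sE] : perm_eq (sort >=%R t) t by rewrite perm_sort.
exists s => i j ij.
have srt : sorted >=%R (sort >=%R t).
  by apply: sort_sorted => x y; exact: le_total.
have := sorted_leq_nth (@ge_trans _ R) (@lexx _ R) 0 srt.
have nthE (l : 'I_n) : nth 0 (sort >=%R t) l = d 0 (s l).
  rewrite sE (nth_map l) ?size_enum_ord// nth_ord_enum.
  by rewrite tnth_map tnth_ord_tuple.
move/(_ i j); rewrite !inE size_sort size_tuple !ltn_ord !nthE.
by apply.
Qed.

Lemma spec_dec_perm n (X U : 'M[C]_n) (d : 'rV[R]_n) (s : 'S_n) :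
  spec_dec X U d -> spec_dec X (col_perm s U) (col_perm s d).
Proof.
move=> [UU ->]; split.
  rewrite /Defs.unitarymx -[RHS]UU; apply/matrixP => i j; rewrite !mxE.
  rewrite [RHS](reindex_inj (@perm_inj _ s)).
  by apply: eq_bigr => l _; rewrite !mxE.
apply/matrixP => i j; rewrite !mul_mx_diag !mxE.
rewrite [LHS](reindex_inj (@perm_inj _ s)).
by apply: eq_bigr => l _; rewrite !mxE.
Qed.

(** Permuting the columns of any decomposition sorts its diagonal, so the default value in [eigs]
    does not occur for positive definite matrices. *)
Lemma eigs_spec_dec n (X : 'M[C]_n) : posdef X ->
  exists (U : 'M[C]_n) (d : 'rV[R]_n), [/\ spec_dec X U d, forall i, 0 < d 0 i,
    forall i j : 'I_n, (i <= j)%N -> d 0 j <= d 0 i & eigs X = d 0].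
Proof.
move=> pX; rewrite /eigs; case: pselect => [h|[]].
  case: (cid h) => -[U d]/= [sX d0 dd].
  by exists U, d; split=> //; exact: posdef_spectral_gt0 sX.
have [[U d]/= [sX d0]] := posdef_spec_dec pX.
have [s hs] := sorting_perm d.
exists (col_perm s U, col_perm s d) => /=; split; first exact: spec_dec_perm.
  by move=> i; rewrite mxE ltW.
by move=> i j ij; rewrite !mxE; exact: hs.
Qed.

End Eigenvalues.

(** * Log-majorization: partial products through compounds, then equality of determinants *)

Theorem theorem4p3 (R : realType) (n : nat) (A B : 'M[R[i]]_n) (t : R) :
  posdef A -> posdef B ->
  (- 2^-1 <= t <= 0) \/ (1 <= t <= 3 / 2) ->
  logmaj (sphat A B t)
         (mpow A ((1 - t) / 2) *m mpow B t *m mpow A ((1 - t) / 2)).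
Proof.
move=> pA pB ht; have pG := gmean_inv_posdef pA pB.
have GE := gmean_inv_riccati pA pB.
rewrite /logmaj /sphat; move: (gmean _ _) pG GE => G pG GE.
have pX := posdef_congr_herm pA (mpow_adj t pG) (mpowVK t pG).
have pY := posdef_congr_herm (mpow_posdef t pB) (mpow_adj ((1 - t) / 2) pA)
  (mpowVK ((1 - t) / 2) pA).
split.
  move=> k /andP[_ kn].
  have {}kn : (k <= n)%N := leq_trans kn (leq_pred n).
  have [U [d [sX d0 dd ->]]] := eigs_spec_dec pX.
  have [V [e [sY e0 ee ->]]] := eigs_spec_dec pY.
  have [r [L [LM Lp Lpow Lle Lge]]] := compound R kn.
  rewrite -/(top_prod (d 0) k) -/(top_prod (e 0) k).
  have c0 : 0 < top_prod (e 0) k by rewrite prodr_gt0.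
  (* The compounds of [A], [B] and [G] satisfy the same Riccati equation, so the operator inequality
     applies to them, with [c] the product of the [k] largest eigenvalues of the right side. *)
  apply: Lge sX _; rewrite !LM !(Lpow _ _ pG).
  apply: (spectral_gmean_le (Lp _ pA) (Lp _ pB) (Lp _ pG) _ ht c0).
    by rewrite -!LM GE.
  rewrite -(Lpow _ _ pA) -(Lpow _ _ pB) -!LM.
  by apply: Lle sY _ ee => i; exact: ltW.
have [a a0 aE] := det_mpow pA; have [b b0 bE] := det_mpow pB.
have [g g0 gE] := det_mpow pG.
(* Determinants of [G A G = B]; what remains is [g^t a g^t = a^((1-t)/2) (g a g)^t a^((1-t)/2)] for
   positive reals. *)
have abg : b = g * a * g.
  apply: rC_inj; rewrite -(powRr1 (ltW b0)) -bE (mpow1 pB) -GE !det_mulmx.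
  by rewrite !rCM -{1 2}(mpow1 pG) gE -(mpow1 pA) aE !powRr1// ltW.
rewrite !det_mulmx !aE bE !gE -[X in \det X](mpow1 pA) aE -!rCM; congr rC.
have powS (x u v : R) : 0 < x -> x `^ u * x `^ v = x `^ (u + v).
  by move=> x0; rewrite powRD// (gt_eqF x0) implybT.
rewrite abg !powRM ?mulr_ge0 ?(ltW a0) ?(ltW g0)//.
transitivity (g `^ t * g `^ t * (a `^ ((1 - t) / 2) * a `^ t * a `^ ((1 - t) / 2))).
  rewrite !(powS a)//; have -> : (1 - t) / 2 + t + (1 - t) / 2 = 1 by field.
  by rewrite mulrAC.
by ring.
Qed.
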